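(* The endomorphisms $\Phi$ and $\partial$ of $\mathbb{Q}\mathfrak{S}^{\pm}$ commute: $\Phi\circ\partial=\partial\circ\Phi$.
   Context: For integers $p\le q$ put $[p,q]=\{p,\dots,q\}$ (empty if $p>q$). For $n\ge 0$, $\mathfrak{S}_n^{\pm}$ denotes the group (under composition) of signed permutations of rank $n$: permutations $\sigma$ of $[-n,n]$ with $\sigma(-i)=-\sigma(i)$ for all $i$ (so $\sigma(0)=0$). A signed permutation is identified with its word $w(\sigma)=\sigma(1)\cdots\sigma(n)$; $\mathfrak{S}_0^{\pm}$ has the single element $\emptyset$ (empty word). Let $\mathcal{W}_n$ be the set of words $u_1\cdots u_n$ in nonzero integers with $\{|u_1|,\dots,|u_n|\}=[1,n]$; $\sigma\mapsto w(\sigma)$ is a bijection $\mathfrak{S}_n^{\pm}\to\mathcal{W}_n$ with inverse denoted $\rho$. Let $s_0=(-1,2,\dots,n)$ and, for $1\le i\le n-1$, let $s_i$ have window $(1,\dots,n)$ with $i,i+1$ exchanged; $\ell$ is word length with respect to $s_0,\dots,s_{n-1}$ and $\mathrm{Des}(\sigma)=\{i\in[0,n-1]:\ell(\sigma s_i)<\ell(\sigma)\}$; equivalently $i\in\mathrm{Des}(\sigma)$ iff $\sigma(i)>\sigma(i+1)$ (with $\sigma(0)=0$). $\mathbb{Q}\mathfrak{S}_n^{\pm}$ is the $\mathbb{Q}$-vector space with basis $\mathfrak{S}_n^{\pm}$, and $\mathbb{Q}\mathfrak{S}^{\pm}=\bigoplus_{n\ge 0}\mathbb{Q}\mathfrak{S}_n^{\pm}$.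 $\Phi$ is the linear endomorphism of $\mathbb{Q}\mathfrak{S}^{\pm}$ with, for $\sigma\in\mathfrak{S}_n^{\pm}$, $\Phi(\sigma)=\sum_{\tau\in\mathfrak{S}_n^{\pm},\ \mathrm{Des}(\tau^{-1})\subseteq\mathrm{Des}(\sigma)}\tau$. For distinct $a,b$ put $\varepsilon(a,b)=1$ if $a<b$ and $-1$ if $a>b$; for distinct $a,b,c$ put $\varepsilon(a,b,c)=\frac12(\varepsilon(a,b)+\varepsilon(b,c))$. For $u=u_1\cdots u_n\in\mathcal{W}_n$ and $i\in[1,n]$, let $j$ be the unique index with $|u_j|=i$ and put $\mathrm{sign}_i(u)=\varepsilon(u_{j-1},u_j,u_{j+1})$ with conventions $u_0=0$, $u_{n+1}=-\infty$. Let $\mathrm{del}_i(u)\in\mathcal{W}_{n-1}$ be the word obtained from $u$ by removing the letter $u_j$ and replacing each remaining letter $a$ by $a+1$ if $a<-i$, by $a$ if $-i<a<i$, and by $a-1$ if $a>i$. For $\sigma\in\mathfrak{S}_n^{\pm}$, $n\ge1$, put $\partial_n^i(\sigma)=\mathrm{sign}_i(w(\sigma))\,\rho(\mathrm{del}_i(w(\sigma)))$ and $\partial_n(\sigma)=\sum_{i=1}^n\partial_n^i(\sigma)$, extended linearly to $\partial_n:\mathbb{Q}\mathfrak{S}_n^{\pm}\to\mathbb{Q}\mathfrak{S}_{n-1}^{\pm}$. The endomorphism $\partial$ of $\mathbb{Q}\mathfrak{S}^{\pm}$ is $\bigoplus_{n\ge1}\partial_n$, with $\partial(\emptyset)=0$.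 *)

(* Defs.v *)
From HB Require Import structures.
From mathcomp Require Import all_boot all_order all_fingroup all_algebra.
From mathcomp Require Import finmap monalg zify.

Set Implicit Arguments.
Unset Strict Implicit.
Unset Printing Implicit Defensive.

Import Order.TTheory GRing.Theory Num.Theory.

Local Open Scope ring_scope.

(* The finite type [-n, n]. *)
Record sint (n : nat) := SInt { sval_int :> int; sint_le : (`|sval_int| <= n)%N }.

HB.instance Definition _ n := [isSub for @sval_int n].
HB.instance Definition _ n := [Choice of sint n by <:].

Section SIntFinite.
Variable n : nat.

Definition sint_rank (x : sint n) : 'I_n.*2.+1 := inord (absz ((x : int) + n%:Z)).

Fact sint_of_rank_le (i : 'I_n.*2.+1) : (absz ((i : nat)%:Z - n%:Z)%R <= n)%N.
Proof. by case: i => i /= hi; lia. Qed.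

Definition sint_of_rank i : sint n := SInt (sint_of_rank_le i).

Fact sint_rankK : cancel sint_rank sint_of_rank.
Proof.
move=> [x hx]; apply: val_inj; rewrite /= inordK /=; last by lia.
by lia.
Qed.

HB.instance Definition _ := Countable.copy (sint n) (can_type sint_rankK).
HB.instance Definition _ : isFinite (sint n) := CanIsFinite sint_rankK.
End SIntFinite.

Fact sopp_le n (x : sint n) : (absz (- (x : int))%R <= n)%N.
Proof. by rewrite abszN sint_le. Qed.

Definition sopp n (x : sint n) : sint n := SInt (sopp_le x).

Definition signed_perms n : {set {perm sint n}} :=
  [set s : {perm sint n} | [forall x, s (sopp x) == sopp (s x)]].

Lemma signed_permsP n (s : {perm sint n}) :
  reflect (forall x, s (sopp x) = sopp (s x)) (s \in signed_perms n).
Proof. by rewrite inE; apply: (iffP forallP) => h x; apply/eqP. Qed.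

Fact signed_perms_group_set n : group_set (signed_perms n).
Proof.
apply/group_setP; split; first by apply/signed_permsP => x; rewrite !perm1.
move=> s t /signed_permsP hs /signed_permsP ht.
by apply/signed_permsP => x; rewrite !permM hs ht.
Qed.

Canonical signed_perms_group n := Group (signed_perms_group_set n).

(* The group of signed permutations of rank n, as a finGroupType.  In MathComp
   the product of permutations is in reverse order: s * t maps x to t (s x). *)
Definition sperm n := subg_of (signed_perms_group n).
HB.instance Definition _ n := FinGroup.on (sperm n).

Coercion perm_of_sperm n (s : sperm n) : {perm sint n} := sgval s.

Lemma spermN n (s : sperm n) x : s (sopp x) = sopp (s x).
Proof. by have /signed_permsP := subgP s. Qed.

(* The elements i and i + 1 of [-n, n], for 0 <= i < n. *)
Definition pt n (i : 'I_n) : sint n :=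
  @SInt n (i : nat)%:Z (ltnW (ltn_ord i)).
Definition ptS n (i : 'I_n) : sint n := @SInt n (i : nat).+1%:Z (ltn_ord i).

Record word n := Word {
  letters :> seq int;
  lettersP : perm_eq [seq `|a|%N | a <- letters] (iota 1 n) }.

HB.instance Definition _ n := [isSub for @letters n].
HB.instance Definition _ n := [Choice of word n by <:].

Fact word_of_subproof n (s : sperm n) :
  perm_eq [seq `|a|%N | a <- [seq (s (ptS i) : int) | i <- enum 'I_n]] (iota 1 n).
Proof.
rewrite -map_comp.
set r := map _ _.
have ur : uniq r.
  rewrite map_inj_uniq ?enum_uniq // => i j /= h.
  have [e|e] : s (ptS i) = s (ptS j) \/ s (ptS i) = s (sopp (ptS j)).
  - rewrite spermN.
    have [e|e] : (s (ptS i) : int) = s (ptS j) \/ (s (ptS i) : int) = - (s (ptS j) : int)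
      by lia.
    + by left; apply: val_inj.
    + by right; apply: val_inj.
  - by have /(congr1 val)/= := perm_inj e => -[/val_inj].
  - by have /(congr1 val)/= := perm_inj e.
have sz : size r = n by rewrite size_map size_enum_ord.
have sub : {subset r <= iota 1 n}.
  move=> k /mapP[i _ ->] /=; rewrite mem_iota.
  have := sint_le (s (ptS i)).
  suff : (s (ptS i) : int) <> 0 by lia.
  move=> e0.
  have e : s (sopp (ptS i)) = s (ptS i).
    by rewrite spermN; apply: val_inj; rewrite /= e0.
  by have /(congr1 val) := perm_inj e.
apply: uniq_perm => //; first exact: iota_uniq.
by have [] := uniq_min_size ur sub; rewrite ?sz ?size_iota.
Qed.

Definition word_of n (s : sperm n) : word n := Word (word_of_subproof s).

Lemma word_of_inj n : injective (@word_of n).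
Proof.
move=> s t /(congr1 val) /= /eq_in_map est.
apply/val_inj/permP => x.
have pos i : s (ptS i) = t (ptS i).
  by apply: val_inj; apply: est; rewrite mem_enum.
have [x0|[[i ->]|[i ->]]] : x = sopp x \/ (exists i, x = ptS i)
    \/ (exists i, x = sopp (ptS i)); last 2 first.
- exact: pos.
- by rewrite [LHS](spermN s) [RHS](spermN t) pos.
- case: x => x hx; have [x0|x0|x0] := ltrgt0P x; last by left; apply: val_inj; rewrite /= x0.
  + have h : (`|x|.-1 < n)%N by lia.
    by right; left; exists (Ordinal h); apply: val_inj => /=; lia.
  + have h : (`|x|.-1 < n)%N by lia.
    by right; right; exists (Ordinal h); apply: val_inj => /=; lia.
have fix0 (u : sperm n) : (u x : int) = 0.
  by have := spermN u x; rewrite -x0 => /(congr1 val) /=; lia.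
by apply: val_inj; rewrite [LHS](fix0 s) [RHS](fix0 t).
Qed.

Section WordOnto.
Variables (n : nat) (u : word n).

Let su : size u = n.
Proof. by rewrite -(size_map absz) (perm_size (lettersP u)) size_iota. Qed.

Let absu k : (k < n)%N -> (0 < `|nth 0%R u k| <= n)%N.
Proof.
move=> hk; have : `|nth 0%R u k|%N \in [seq `|a|%N | a <- u].
  by apply: map_f; rewrite mem_nth ?su.
by rewrite (perm_mem (lettersP u)) mem_iota; lia.
Qed.

Let f0 (x : sint n) : int := sgz (x : int) * nth 0%R u `|(x : int)|.-1.

Let f_le x : (`|f0 x| <= n)%N.
Proof.
rewrite /f0; case: x => x hx /=.
have [x0|x0|->] := ltrgt0P x; last by rewrite sgz0 mul0r.
- rewrite gtr0_sgz // mul1r; have /absu : ((absz x).-1 < n)%N by lia.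
  by case/andP.
- rewrite ltr0_sgz // mulN1r abszN; have /absu : ((absz x).-1 < n)%N by lia.
  by case/andP.
Qed.

Let f x : sint n := SInt (f_le x).

Let f_inj : injective f.
Proof.
have uu : uniq [seq `|a|%N | a <- u] by rewrite (perm_uniq (lettersP u)) iota_uniq.
have inj k l : (k < n)%N -> (l < n)%N -> `|nth 0%R u k|%N = `|nth 0%R u l|%N -> k = l.
  move=> hk hl e; apply/eqP.
  rewrite -(nth_uniq 0%N _ _ uu) ?size_map ?su //.
  by rewrite !(nth_map 0) ?su // e.
have absf x : `|f0 x|%N = if (x : int) == 0 then 0%N else `|nth 0%R u `|(x : int)|.-1|%N.
  rewrite /f0; case: x => x hx /=; case: eqP => [->|x0]; first by rewrite sgz0 mul0r.
  have [h|h|h] := ltrgt0P x; last by [].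
    by rewrite gtr0_sgz // mul1r.
  by rewrite ltr0_sgz // mulN1r abszN.
have pos (x : sint n) : (x : int) <> 0 -> (0 < `|nth 0%R u `|(x : int)|.-1|)%N.
  case: x => x hx /= x0; have /absu : ((absz x).-1 < n)%N by lia.
  by case/andP.
have sg_nz (a : int) : a <> 0 -> sgz a = if 0 < a then 1 else -1.
  by have [h _|h _|] := ltrgt0P a; [exact: gtr0_sgz | exact: ltr0_sgz |].
move=> x y /(congr1 val) /= e.
have e' : `|f0 x|%N = `|f0 y|%N by rewrite e.
apply: val_inj => /=; move: e'; rewrite !absf.
case: eqP => [x0|x0]; case: eqP => [y0|y0]; first by rewrite x0 y0.
- by have := pos _ y0; lia.
- by have := pos _ x0; lia.
have hx := sint_le x; have hy := sint_le y.
move=> /inj exy; have {}exy : `|(x : int)|.-1 = `|(y : int)|.-1 by apply: exy; lia.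
have nz := pos _ x0; move: e; rewrite /f0 exy.
rewrite (sg_nz _ x0) (sg_nz _ y0).
by rewrite exy in nz; do 2!case: ifP; rewrite ?mul1r ?mulN1r; lia.
Qed.

Lemma word_of_onto : exists s : sperm n, word_of s == u.
Proof.
have hs : perm f_inj \in signed_perms n.
  apply/signed_permsP => x; rewrite !permE; apply: val_inj.
  by rewrite /= /f0 /= sgzN abszN mulNr.
exists (Subg hs); apply/eqP; apply: val_inj => /=.
apply: (@eq_from_nth _ 0); rewrite size_map size_enum_ord ?su // => k hk.
rewrite (nth_map (Ordinal hk)) ?size_enum_ord //.
have -> : nth (Ordinal hk) (enum 'I_n) k = Ordinal hk.
  by apply: val_inj; rewrite /= nth_enum_ord.
by rewrite /perm_of_sperm /= permE /= /f0 /= gtr0_sgz // mul1r.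
Qed.
End WordOnto.

Definition rho n (u : word n) : sperm n := xchoose (word_of_onto u).

Lemma rhoK n : cancel (@rho n) (@word_of n).
Proof. by move=> u; apply/eqP/(xchooseP (word_of_onto u)). Qed.

Lemma word_ofK n : cancel (@word_of n) (@rho n).
Proof. by move=> s; apply: word_of_inj; rewrite rhoK. Qed.

(* s_0 = (-1 1) and s_i = (i i+1)(-i -i-1) for i > 0. *)
Definition simple_perm n (i : 'I_n) : {perm sint n} :=
  if (i : nat) == 0%N then tperm (sopp (ptS i)) (ptS i)
  else (tperm (pt i) (ptS i) * tperm (sopp (pt i)) (sopp (ptS i)))%g.

Lemma soppK n : involutive (@sopp n).
Proof. by move=> x; apply: val_inj; rewrite /= opprK. Qed.

Lemma tperm_sopp n (a b x : sint n) :
  tperm (sopp a) (sopp b) (sopp x) = sopp (tperm a b x).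
Proof.
have sopp_inj := can_inj (@soppK n).
by rewrite !permE /= !(inj_eq sopp_inj); do 2?case: ifP.
Qed.

Fact simple_perm_signed n (i : 'I_n) : simple_perm i \in signed_perms n.
Proof.
apply/signed_permsP => x; rewrite /simple_perm; case: eqP => i0.
  by rewrite -tperm_sopp soppK tpermC.
set tA := tperm (pt i) _; set tB := tperm (sopp _) _.
have eJ : (tA ^ tB)%g = tA.
  by rewrite tpermJ !tpermD //; apply/eqP => /(congr1 val) /=; lia.
have tAN y : tA (sopp y) = sopp (tB y) by rewrite -tperm_sopp !soppK.
by rewrite {1}conjgC eJ permM tperm_sopp tAN permM.
Qed.

Definition simple n (i : 'I_n) : sperm n := Subg (simple_perm_signed i).

Definition simples n : {set sperm n} := [set simple i | i : 'I_n].

Section Generation.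
Variable n : nat.

Let wt (s : sperm n) : int := \sum_(x : sint n) (x : int) * s x.

Let wt_tperm (a b : sint n) (g : sint n -> int) :
  \sum_(x : sint n) (x : int) * g (tperm a b x) =
  \sum_(x : sint n) (x : int) * g x + ((a : int) - (b : int)) * (g b - g a).
Proof.
have [->|ab] := eqVneq a b.
  by rewrite subrr mul0r addr0; apply: eq_bigr => x _; rewrite tperm1 perm1.
rewrite [in LHS](bigD1 a) //= [in RHS](bigD1 a) //=.
rewrite [in LHS](bigD1 b) 1?eq_sym //= [in RHS](bigD1 b) 1?eq_sym //=.
rewrite tpermL tpermR; set S1 := \sum_(i | _) _; set S2 := \sum_(i | _) _.
have -> : S1 = S2.
  by apply: eq_bigr => x /andP[xa xb]; rewrite tpermD // eq_sym.
by rewrite !mulrBl !mulrBr; lia.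
Qed.

Let wt_simple (s : sperm n) i : (s (ptS i) : int) < s (pt i) ->
  wt s < wt (simple i * s)%g.
Proof.
move=> h; rewrite /wt /=.
have -> : \sum_(x : sint n) (x : int) * ((simple i * s)%g : sperm n) x =
    \sum_(x : sint n) (x : int) * (s (simple_perm i x) : int).
  by apply: eq_bigr => x _; rewrite /perm_of_sperm /= permM.
rewrite /simple_perm; case: eqP => i0.
  rewrite (wt_tperm _ _ (fun x => s x : int)) spermN /=.
  have e : (s (pt i) : int) = 0.
    have /(congr1 (fun x => s x : int)) : sopp (pt i) = pt i.
      by apply: val_inj; rewrite /= i0.
    by rewrite spermN /=; lia.
  by rewrite i0; lia.
under [X in _ < X]eq_bigr => x _ do rewrite permM.
rewrite (wt_tperm _ _ (fun x => s (tperm (sopp (pt i)) (sopp (ptS i)) x) : int)).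
rewrite (wt_tperm _ _ (fun x => s x : int)) !spermN /=.
rewrite !tpermD; try by apply/eqP => /(congr1 val) /=; lia.
by lia.
Qed.

Let nodes_id (s : sperm n) :
  (forall i, (s (pt i) : int) <= s (ptS i)) -> s = 1%g.
Proof.
move=> h.
have hlt i : (s (pt i) : int) < s (ptS i).
  rewrite lt_neqAle h andbT; apply/eqP => /val_inj/perm_inj/(congr1 val) /=; lia.
pose g (k : nat) : int := if insub k%:Z is Some x then s x else 0.
have gE k (hk : (`|k%:Z| <= n)%N) : g k = s (SInt hk).
  by rewrite /g insubT.
have gS k : (k < n)%N -> g k < g k.+1.
  move=> hk; have h1 : (absz k%:Z <= n)%N by lia.
  have h2 : (absz k.+1%:Z <= n)%N by lia.
  rewrite (gE _ h1) (gE _ h2).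
  have -> : SInt h1 = pt (Ordinal hk) :> sint n by apply: val_inj.
  have -> : SInt h2 = ptS (Ordinal hk) :> sint n by apply: val_inj.
  exact: hlt.
have g0 : g 0%N = 0.
  rewrite gE //; set x := SInt _.
  have : sopp x = x by apply: val_inj.
  by move=> /(congr1 (fun x => s x : int)); rewrite spermN /=; lia.
have gge k : (k <= n)%N -> k%:Z <= g k.
  elim: k => [|k IH] hk; first by rewrite g0.
  by have := gS k hk; have := IH (ltnW hk); lia.
have gle m : (m <= n)%N -> g (n - m)%N <= (n - m)%N%:Z.
  elim: m => [|m IH] hm.
    have hn : (absz n%:Z <= n)%N by lia.
    by rewrite subn0 (gE _ hn); have := sint_le (s (SInt hn)); lia.
  have := gS (n - m.+1)%N; have -> : (n - m.+1).+1 = (n - m)%N by lia.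
  by have := IH (ltnW hm); lia.
have gk k : (k <= n)%N -> g k = k%:Z.
  move=> hk; have := gle (n - k)%N; have := gge k hk.
  by have -> : (n - (n - k) = k)%N; lia.
have spos (x : sint n) : 0 <= (x : int) -> s x = x.
  case: x => x hx /= x0; apply: val_inj => /=.
  by case: x hx x0 => // k hk _; rewrite -gE gk.
apply/val_inj/permP => x; rewrite perm1 /=.
have [x0|x0] := lerP 0 (x : int); first exact: spos.
rewrite -[x in LHS]soppK [LHS](spermN s) spos ?soppK //=; lia.
Qed.

Lemma gen_simples : <<simples n>>%g = [set: sperm n].
Proof.
apply/setP => s; rewrite inE.
have ss : s \in (<<simples n>> :* s)%g by rewrite rcoset_refl.
case: (@arg_maxP _ _ _ s (mem (<<simples n>> :* s)%g) wt ss) => t ts tmax.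
have t1 : t = 1%g.
  apply: nodes_id => i; rewrite leNgt; apply/negP => /wt_simple.
  rewrite ltNge => /negP; apply; apply: tmax.
  have /rcosetP[x xG ->] := ts.
  rewrite mulgA; apply/rcosetP; exists (simple i * x)%g => //.
  by rewrite groupM // mem_gen // imset_f.
have {}ts : t \in (<<simples n>> :* s)%g := ts.
by move: ts; rewrite t1 mem_rcoset mul1g groupV.
Qed.
End Generation.

Fact length_subproof n (s : sperm n) : exists k, s \in (simples n ^+ k)%g.
Proof.
have : s \in <<simples n>>%g by rewrite gen_simples inE.
case/gen_prodgP => k [c hc ->]; exists k.
elim: k c hc => [|k IH] c hc; first by rewrite big_ord0 expg0 set11.
rewrite big_ord_recl expgS; apply: mem_mulg; first exact: hc.
by apply: IH => i; apply: hc.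
Qed.

(* simples n ^+ k is the set of products of k simple generators. *)
Definition length n (s : sperm n) : nat := ex_minn (length_subproof s).

(* Because of the MathComp product, simple i * s is the composite s o s_i. *)
Definition Des n (s : sperm n) : {set 'I_n} :=
  [set i : 'I_n | (length (simple i * s)%g < length s)%N].

Definition spermT : Type := {n : nat & sperm n}.
HB.instance Definition _ := Choice.on spermT.

(* The free Q-vector space on the disjoint union of the bases, which is the
   direct sum of the spaces spanned by the signed permutations of rank n. *)
Notation QS := {malg rat[spermT]}.

Definition basis n (s : sperm n) : QS := << Tagged sperm s >>.

Definition linext (F : spermT -> QS) (g : QS) : QS :=
  \sum_(k <- msupp g) g@_k *: F k.

Lemma linextEw F (g : QS) (d : {fset spermT}) : (msupp g `<=` d)%fset ->
  linext F g = \sum_(k <- d) g@_k *: F k.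
Proof.
move=> hd; rewrite /linext (big_fset_incl _ hd) //= => k _ hk.
by rewrite mcoeff_outdom // scale0r.
Qed.

Fact linext_is_linear F : linear (linext F).
Proof.
move=> c g h; pose d := (msupp g `|` msupp h `|` msupp (c *: g + h))%fset.
have sg : (msupp g `<=` d)%fset by rewrite /d -fsetUA fsubsetUl.
have sh : (msupp h `<=` d)%fset by rewrite /d fsetUAC fsubsetUr.
have sgh : (msupp (c *: g + h) `<=` d)%fset by rewrite fsubsetUr.
rewrite (linextEw F sg) (linextEw F sh) (linextEw F sgh).
rewrite scaler_sumr -big_split /=; apply: eq_bigr => k _.
by rewrite mcoeffD mcoeffZ scalerDl scalerA.
Qed.

HB.instance Definition _ F :=
  GRing.isLinear.Build rat QS QS *:%R (linext F) (linext_is_linear F).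

Lemma linext_basis F n (s : sperm n) : linext F (basis s) = F (Tagged sperm s).
Proof.
rewrite (@linextEw F _ [fset Tagged sperm s]%fset); last exact: msuppU_le.
by rewrite big_seq_fset1 /basis mcoeffU eqxx scale1r.
Qed.

Definition Phi : {linear QS -> QS} :=
  linext (fun k : spermT =>
    \sum_(t : sperm (tag k) | Des t^-1%g \subset Des (tagged k)) basis t).

(* The order on letters, None standing for -oo. *)
Definition lt_letter (a b : option int) : bool :=
  match a, b with
  | Some a, Some b => a < b
  | None, Some _ => true
  | _, None => false
  end.

(* Only used for a <> b. *)
Definition eps2 (a b : option int) : rat := if lt_letter a b then 1 else -1.

Definition eps3 (a b c : option int) : rat := (eps2 a b + eps2 b c) / 2%:R.

(* u_0, ..., u_{n+1} with u_0 = 0 and u_{n+1} = -oo. *)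
Definition ext_letters (u : seq int) : seq (option int) :=
  Some 0 :: rcons [seq Some a | a <- u] None.

Definition sign_at (i : nat) (u : seq int) : rat :=
  let j := (index i [seq `|a|%N | a <- u]).+1 in
  let v := nth None (ext_letters u) in
  eps3 (v j.-1) (v j) (v j.+1).

Definition shift_letter (i : nat) (a : int) : int :=
  if a < - i%:Z then a + 1 else if i%:Z < a then a - 1 else a.

(* i + 1 runs over [1, n + 1] when i runs over 'I_n.+1. *)
Fact del_subproof n (i : 'I_n.+1) (u : word n.+1) :
  perm_eq [seq `|a|%N
          | a <- [seq shift_letter i.+1 a | a <- u & `|a|%N != i.+1]] (iota 1 n).
Proof.
pose g k := if (i.+1 < k)%N then k.-1 else k.
have -> : [seq `|a|%N | a <- [seq shift_letter i.+1 a | a <- u & `|a|%N != i.+1]] =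
    map g [seq k <- [seq `|a|%N | a <- u] | k != i.+1].
  rewrite filter_map -!map_comp; apply/eq_in_map => a.
  rewrite mem_filter => /andP[/= ha _]; rewrite /shift_letter /g.
  by do !case: ifP; lia.
rewrite (permPl (perm_map g (perm_filter (fun k => k != i.+1) (lettersP u)))).
have hi := ltn_ord i.
apply: uniq_perm; [|exact: iota_uniq|].
  rewrite map_inj_in_uniq ?filter_uniq ?iota_uniq // => k l.
  by rewrite !mem_filter /g => /andP[hk _] /andP[hl _]; do 2!case: ifP; lia.
move=> k; rewrite mem_iota; apply/mapP/idP => [[l]|hk].
  by rewrite mem_filter mem_iota /g => hl ->; case: ifP; lia.
exists (if (k <= i)%N then k else k.+1); last by rewrite /g; do 2!case: ifP; lia.
by rewrite mem_filter mem_iota; case: ifP; lia.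
Qed.

Definition del n (i : 'I_n.+1) (u : word n.+1) : word n :=
  Word (del_subproof i u).

Definition face n (i : 'I_n.+1) (s : sperm n.+1) : QS :=
  sign_at i.+1 (word_of s) *: basis (rho (del i (word_of s))).

Definition partial_basis n : sperm n -> QS :=
  match n with
  | 0 => fun=> 0
  | m.+1 => fun s => \sum_(i < m.+1) face i s
  end.

Definition partial : {linear QS -> QS} :=
  linext (fun k : spermT => partial_basis (tagged k)).

(* Main.v *)
Require Import Defs.
From mathcomp Require Import all_boot all_order all_fingroup all_algebra.
From mathcomp Require Import finmap monalg zify.

(** Fix a signed permutation [s] of rank [n], a value [v] in [1, n] and a signed
    permutation [d] of rank [n - 1], and consider the signed permutations [t]
    with [Des t^-1] included in [Des s] from which deleting [v] yields [d].
    The theorem follows from the fact that their signs at [v] add up to the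
    sign of [s] at position [v] when [Des d^-1] is included in the descent set
    of [s] with its letter at position [v] deleted, and to 0 otherwise
    ([sum_sign_fiber] together with [Des_deletion]).  Summing over [v] gives the
    coefficient of [d] in [partial (Phi s)] on one side, and the one in
    [Phi (partial s)], a sum over the letters of [s] reindexed by their
    positions, on the other.

    To see this fact, extend every signed permutation to an odd bijection [ext]
    of the integers by [x |-> - x] outside [-n, n].  The last letter is then
    followed by [-(n + 1)], a faithful substitute for the convention
    [u_(n+1) = -oo], and oddness makes the sign at a letter depend only on its
    neighbours in the doubly infinite word, whether one reads it at [v] or at
    [-v] ([sign_at_signed]).  Recovering [t] from [d] amounts to choosing one of
    the [2n] gaps between consecutive positions of [-n, n] in the extended
    word of [d], where the letter [v] is inserted ([-v] going to the
    opposite gap).  Write [h x] for 1 or -1 according to whether the letter of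
    [d] at position [x] ends up below [v] or above it; the sign of [t] at [v] is
    [(h g - h (g + 1)) / 2] for the gap [g] ([sign_at_gap]).  The condition on
    [Des t^-1] splits into a condition on [d] alone, away from [v], and two
    conditions on the gap: it must lie to the right of the letter [v - 1] if
    [v - 1] is not a descent of [s], and to the left of the letter [v] of [d],
    which becomes [v + 1] in [t], if [v] is not a descent of [s]
    ([Des_insertion]).  The admissible gaps thus form an interval and the sum of
    the signs telescopes to [(h lo - h hi) / 2].  If the interval starts at the
    letter [v - 1] then [h lo = 1], and if it is unbounded on the left then
    [h lo = -1], since the extended word of [d] has a large letter there; so
    [h lo] is 1 at an ascent [v - 1] of [s] and -1 at a descent, and likewise
    for [- h hi] and [v].  This is the sign of [s] at position [v].  The interval
    is empty only if both [v - 1] and [v] are ascents of [s] and [v - 1] is a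
    descent of [d^-1], which is exactly when merging the two ascents of [s]
    into one, by deleting position [v], violates the inclusion of descent
    sets.

    Descents being defined through the length function, all this rests on
    their description by [s (i + 1) < s i], obtained from the exchange condition
    ([mem_Des]). *)

Set Implicit Arguments.
Unset Strict Implicit.
Unset Printing Implicit Defensive.

Import Order.TTheory GRing.Theory Num.Theory.

Local Open Scope ring_scope.

(** * Descents and the exchange condition *)

Lemma simpleE n (a : 'I_n) (x : sint n) : (simple a x : int) =
  if (a : nat) == 0%N then (if (`|(x : int)| == 1)%N then - (x : int) else x)
  else if `|(x : int)|%N == a then (x : int) + sgz (x : int)
  else if `|(x : int)|%N == a.+1 then (x : int) - sgz (x : int) else x.
Proof.
rewrite /perm_of_sperm /= /simple_perm.
have E (b c : sint n) : (b == c) = ((b : int) == (c : int)) by [].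
case: eqP => a0; first by rewrite permE /= !E /= a0; do !case: ifP => /=; lia.
rewrite permM !permE /= !E /=.
by do !case: ifP => /=; lia.
Qed.

(** A simple generator reverses very few pairs.  For [a = 0] the pairs inside
    {-1, 0, 1} are kept together here, since [simple_conj] treats them alike. *)
Lemma simple_inversion n (a : 'I_n) (x y : sint n) :
  (x : int) < y -> (simple a y : int) < simple a x ->
  (0 < a)%N /\ (x = pt a /\ y = ptS a \/ x = sopp (ptS a) /\ y = sopp (pt a))
  \/ (a = 0%N :> nat) /\ -1 <= (x : int) /\ (y : int) <= 1.
Proof.
have E (b c : sint n) : (b : int) = c -> b = c by move=> e; apply: val_inj.
rewrite !simpleE => xy; case: eqP => [a0|a0] h; [right | left].
  by move: h; do !case: ifP; lia.
split; first by lia.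
suff [[e1 e2]|[e1 e2]] : (x : int) = a /\ (y : int) = a.+1 \/
   (x : int) = - (a.+1%:Z) /\ (y : int) = - (a%:Z).
- by left; split; apply: E.
- by right; split; apply: E; rewrite /= ?e1 ?e2; lia.
by move: h; do !case: ifP; lia.
Qed.

(** The generator [simple i] is the reflection attached to the pair
    [(i, i + 1)], so its conjugate by [g] is the one attached to the image pair;
    a simple generator reversing that pair has to be the same reflection. *)
Lemma simple_conj n (i a : 'I_n) (g : sperm n) :
  (g (pt i) : int) < g (ptS i) -> (simple a (g (ptS i)) : int) < simple a (g (pt i)) ->
  (simple i ^ g = simple a)%g.
Proof.
have E (b c : sint n) : (b : int) = c -> b = c by move=> e; apply: val_inj.
have gz (z : sint n) : (z : int) = 0 <-> (g z : int) = 0.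
  split=> h.
    by have /(congr1 val) := spermN g z; rewrite (E (sopp z) z) /=; lia.
  have /(congr1 val) /= : sopp z = z; last by lia.
  by apply: (@perm_inj _ (g : {perm _})); apply: E; rewrite spermN /= h.
move=> lt1 lt2; apply: val_inj.
rewrite conjgE /= -conjgE /simple_perm.
case: (simple_inversion lt1 lt2) => [[a0 H]|[a0 [H1 H2]]].
  have -> : ((a : nat) == 0%N) = false by lia.
  case: eqP => i0.
    have /gz : (pt i : int) = 0 by rewrite /= i0.
    by case: H => -[-> _] /=; lia.
  rewrite conjMg !tpermJ -/(perm_of_sperm g) !spermN.
  case: H => -[-> ->] //.
  rewrite !soppK [tperm (sopp _) _]tpermC [tperm (ptS _) _]tpermC conjgC tpermJ.
  by rewrite !tpermD //; apply/eqP => /(congr1 val) /=; lia.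
have nz : (g (ptS i) : int) <> 0 by move=> /(gz _).2 /=; lia.
rewrite a0 eqxx; case: eqP => i0.
  have /gz z0 : (pt i : int) = 0 by rewrite /= i0.
  have e : g (ptS i) = ptS a by apply: E; rewrite /= a0; lia.
  by rewrite tpermJ -/(perm_of_sperm g) spermN e.
have nz' : (g (pt i) : int) <> 0 by move=> /(gz _).2 /=; lia.
have : g (ptS i) = g (sopp (pt i)) by apply: E; rewrite spermN /=; lia.
by move=> /perm_inj /(congr1 val) /=; lia.
Qed.

Lemma simple2 n (a : 'I_n) : (simple a * simple a = 1)%g.
Proof.
apply: val_inj; apply/permP => x; rewrite permM perm1.
by apply: val_inj => /=; rewrite !simpleE; do !case: ifP => /=; lia.
Qed.

Lemma sperm1 n x : (1%g : sperm n) x = x.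
Proof. by rewrite /perm_of_sperm /= perm1. Qed.

Lemma spermM n (s t : sperm n) x : ((s * t)%g : sperm n) x = t (s x).
Proof. by rewrite /perm_of_sperm /= permM. Qed.

(** The exchange condition: along a product of [k] generators the pair
    [(g i, g (i + 1))] is reversed at some factor, which equals the conjugate of
    [simple i] transported there, so that multiplying by the reflection cancels
    this factor.  The case of interest is [g = 1]; a general [g] records the
    factors already passed in the induction on [k]. *)
Lemma exchange n k (s g : sperm n) (i : 'I_n) :
  s \in (simples n ^+ k)%g -> (g (pt i) : int) < g (ptS i) ->
  (s (g (ptS i)) : int) < s (g (pt i)) ->
  exists2 k', (k' < k)%N & (simple i ^ g * s)%g \in (simples n ^+ k')%g.
Proof.
elim: k s g => [|k IH] s g.
  by rewrite expg0 inE => /eqP ->; rewrite /perm_of_sperm /= !perm1; lia.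
rewrite expgS => /mulsgP[_ t /imsetP[a _ ->] ht ->] lt1.
rewrite !spermM => lt2.
have [le|lt] := leP (simple a (g (ptS i)) : int) (simple a (g (pt i)) : int).
  exists k => //; rewrite (@simple_conj _ _ a) // ?mulgA ?simple2 ?mul1g //.
  rewrite lt_neqAle le andbT; apply/eqP => /val_inj/perm_inj/perm_inj.
  by move=> /(congr1 val) /=; lia.
have [] := IH t (g * simple a)%g ht; rewrite ?spermM // => k' kk' hk'.
exists k'.+1; rewrite // expgS.
have -> : (simple i ^ g * (simple a * t) =
           simple a * (simple i ^ (g * simple a) * t))%g.
  by rewrite [LHS]mulgA [RHS]mulgA conjgM -conjgC.
by rewrite mem_mulg // imset_f.
Qed.

Lemma length_in n (s : sperm n) : s \in (simples n ^+ length s)%g.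
Proof. by rewrite /length; case: ex_minnP. Qed.

Lemma length_min n (s : sperm n) k : s \in (simples n ^+ k)%g -> (length s <= k)%N.
Proof. by rewrite /length; case: ex_minnP => m _ h /h. Qed.

(** One direction is the exchange condition.  The other one is the same
    statement for [simple i * s], which has an inversion at [i] when [s] has
    none. *)
Lemma mem_Des n (s : sperm n) (i : 'I_n) : (i \in Des s) = ((s (ptS i) : int) < s (pt i)).
Proof.
have aux (t : sperm n) : (t (ptS i) : int) < t (pt i) ->
    (length (simple i * t)%g < length t)%N.
  move=> lt; have [||k' kk'] := exchange (g := 1%g) (i := i) (length_in t).
  - by rewrite !sperm1 /= ltz_nat.
  - by rewrite !sperm1.
  by rewrite conjg1 => /length_min h; exact: leq_ltn_trans h kk'.
rewrite inE; apply/idP/idP; last exact: aux.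
apply: contraTT; rewrite -!leNgt -leqNgt => le.
rewrite ltnW //; rewrite -{1}[s]mul1g -(simple2 i) -mulgA; apply: aux.
have E (b c : sint n) : (b : int) = c -> b = c by move=> e; apply: val_inj.
have {le}lt : (s (pt i) : int) < s (ptS i).
  rewrite lt_neqAle le andbT; apply/eqP => /val_inj/perm_inj /(congr1 val) /=; lia.
rewrite !spermM; case: (posnP i) => i0.
  have -> : simple i (ptS i) = sopp (ptS i) by apply: E; rewrite simpleE /= i0.
  have -> : simple i (pt i) = pt i by apply: E; rewrite simpleE /= i0.
  have /(congr1 val) /= : s (sopp (pt i)) = s (pt i).
    by congr (perm_of_sperm s _); apply: E; rewrite /= i0.
  by rewrite !spermN /=; lia.
have -> : simple i (ptS i) = pt i.
  by apply: E; rewrite simpleE /=; do !case: ifP; lia.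
have -> // : simple i (pt i) = ptS i.
by apply: E; rewrite simpleE /=; do !case: ifP; lia.
Qed.

(** * Signed permutations as odd bijections of the integers *)

(** The value [- x] outside [-n, n] keeps the function odd and injective, and
    makes the letter at position [n + 1] smaller than all the others: it plays
    the part of [-oo]. *)
Definition ext n (s : sperm n) (x : int) : int :=
  if (insub x : option (sint n)) is Some y then s y else - x.

Lemma ext_val n (s : sperm n) (y : sint n) : ext s y = s y.
Proof. by rewrite /ext valK. Qed.

Lemma ext_out n (s : sperm n) x : (n < `|x|)%N -> ext s x = - x.
Proof. by move=> h; rewrite /ext insubN // -ltnNge. Qed.

Lemma sintP n (x : int) : (exists y : sint n, x = y) \/ (n < `|x|)%N.
Proof. by case: (leqP `|x| n) => h; [left; exists (SInt h) | right]. Qed.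

Lemma extN n (s : sperm n) x : ext s (- x) = - ext s x.
Proof.
case: (sintP n x) => [[y ->]|h]; last by rewrite !ext_out ?abszN.
by rewrite -[- _]/(sopp y : int) !ext_val spermN.
Qed.

Lemma ext0 n (s : sperm n) : ext s 0 = 0.
Proof. by move: (extN s 0); rewrite oppr0; set e := ext s 0; lia. Qed.

Lemma extK n (s : sperm n) : cancel (ext s) (ext s^-1%g).
Proof.
move=> x; case: (sintP n x) => [[y ->]|h].
  by rewrite !ext_val -spermM mulgV sperm1.
by rewrite (ext_out s) // ext_out ?abszN // opprK.
Qed.

Lemma extVK n (s : sperm n) : cancel (ext s^-1%g) (ext s).
Proof. by move=> x; rewrite -{1}[s]invgK extK. Qed.

Lemma ext_inj n (s : sperm n) : injective (ext s).
Proof. exact: can_inj (extK s). Qed.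

Lemma ext_eq n (s t : sperm n) : ext s =1 ext t -> s = t.
Proof.
move=> st; apply/val_inj/permP => y; apply: val_inj.
by move: (st y); rewrite !ext_val.
Qed.

Lemma ext_range n (s : sperm n) x : (`|ext s x| <= n)%N = (`|x| <= n)%N.
Proof.
case: (sintP n x) => [[y ->]|h]; last by rewrite ext_out ?abszN.
by rewrite ext_val !sint_le.
Qed.

Lemma ext_realize n (f : int -> int) : injective f -> (forall x, f (- x) = - f x) ->
  (forall x, (`|x| <= n)%N -> (`|f x| <= n)%N) ->
  exists s : sperm n, forall x, (`|x| <= n)%N -> ext s x = f x.
Proof.
move=> fI fN fle.
pose g (y : sint n) : sint n := SInt (fle y (sint_le y)).
have gI : injective g by move=> y z /(congr1 val) /= /fI /val_inj.
have hg : perm gI \in signed_perms n.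
  by apply/signed_permsP => y; rewrite !permE; apply: val_inj; rewrite /= fN.
exists (Subg hg) => x h.
by rewrite -[x]/(SInt h : int) ext_val /perm_of_sperm /= permE.
Qed.

Lemma word_ofE n (s : sperm n) :
  word_of s = mkseq (fun k => ext s k.+1%:Z) n :> seq int.
Proof.
rewrite /= /mkseq -val_enum_ord -map_comp; apply: eq_map => i.
by rewrite /= -[Posz i.+1]/(ptS i : int) ext_val.
Qed.

Lemma size_word n (s : sperm n) : size (word_of s) = n.
Proof. by rewrite word_ofE size_mkseq. Qed.

Lemma nth_word n (s : sperm n) k : (k < n)%N -> nth 0 (word_of s) k = ext s k.+1.
Proof. by move=> h; rewrite word_ofE nth_mkseq. Qed.

Lemma uniq_word n (u : word n) : uniq [seq `|a|%N | a <- u].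
Proof. by rewrite (perm_uniq (lettersP u)) iota_uniq. Qed.

Lemma index_word n (s : sperm n) k : (k < n)%N ->
  index `|ext s k.+1|%N [seq `|a|%N | a <- word_of s] = k.
Proof.
move=> h; rewrite -(nth_word s h) -(nth_map 0 0%N) ?size_word //.
by rewrite index_uniq ?uniq_word // size_map size_word.
Qed.

Definition asc (f : int -> int) (x : int) : bool := f x < f (x + 1).
Definition step (f : int -> int) (x : int) : int := sgz (f (x + 1) - f x).

Lemma step_ext n (s : sperm n) x : step (ext s) x = if asc (ext s) x then 1 else -1.
Proof.
rewrite /step /asc.
have : ext s x <> ext s (x + 1) by move=> /ext_inj; lia.
by move: (ext s x) (ext s (x + 1)) => a b; case: ifP; lia.
Qed.

Lemma Des_asc n (s : sperm n) (i : 'I_n) : (i \in Des s) = ~~ asc (ext s) i.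
Proof.
rewrite mem_Des /asc -leNgt -!ext_val /= -PoszD addn1 lt_neqAle.
by case: eqP => // /ext_inj; lia.
Qed.

Lemma asc_last n (s : sperm n) (x : int) : x = n -> asc (ext s) x = false.
Proof.
move=> ->; rewrite /asc (@ext_out _ s (_ + 1)); last by lia.
by have := ext_range s n; lia.
Qed.

Lemma Des_subset n (s t : sperm n) :
  (Des s \subset Des t) = [forall i : 'I_n, asc (ext t) i ==> asc (ext s) i].
Proof.
apply/subsetP/forallP => h i; have := h i; rewrite !Des_asc; do 2!case: (asc _ _) => //=.
by move=> /(_ isT).
Qed.

Lemma nth_ext_letters n (s : sperm n) k : (k <= n.+1)%N ->
  nth None (ext_letters (word_of s)) k = if (k <= n)%N then Some (ext s k) else None.
Proof.
case: k => [|k] h; first by rewrite /= ext0.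
rewrite -nth_behead -[behead _]/(rcons [seq Some a | a <- word_of s] None).
rewrite nth_rcons size_map size_word; case: (ltnP k n) => kn.
  by rewrite (nth_map 0) ?size_word // nth_word.
by case: eqP.
Qed.

(** At [k = n] both sides are -1, on the left because the next letter is
    [-oo], on the right because it is [- (n + 1)]. *)
Lemma eps2_step n (s : sperm n) k : (k <= n)%N ->
  eps2 (nth None (ext_letters (word_of s)) k) (nth None (ext_letters (word_of s)) k.+1)
  = (step (ext s) k)%:~R.
Proof.
move=> h; rewrite !nth_ext_letters ?h; try lia.
rewrite step_ext /eps2 /=; case: ltnP => h1 /=.
  by rewrite /asc -PoszD addn1; case: ifP.
by rewrite asc_last //; lia.
Qed.

Lemma sign_at_pos n (s : sperm n) k : (k < n)%N ->
  sign_at `|ext s k.+1|%N (word_of s) = (step (ext s) k + step (ext s) k.+1)%:~R / 2%:R.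
Proof.
move=> h; rewrite /sign_at index_word // /eps3.
by rewrite !eps2_step ?rmorphD //; lia.
Qed.

(** Read backwards and negated, the extended word is itself; hence the sign at
    a letter can be computed at its position [q] even if [q] is negative, that
    is, if the opposite letter is the one that occurs in the word. *)
Lemma sign_at_signed n (s : sperm n) q : q <> 0 -> (`|q| <= n)%N ->
  sign_at `|ext s q|%N (word_of s) = (step (ext s) (q - 1) + step (ext s) q)%:~R / 2%:R.
Proof.
move=> q0 qn; have h : (`|q|.-1 < n)%N by lia.
have stepN x : step (ext s) (- x - 1) = step (ext s) x.
  rewrite /step (_ : - x - 1 + 1 = - x); last by lia.
  rewrite (_ : - x - 1 = - (x + 1)); last by lia.
  by rewrite !extN opprK addrC.
have [q_gt|q_lt|//] := ltrgt0P q.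
  have e : q = `|q|.-1.+1%:Z by lia.
  rewrite e sign_at_pos //; congr ((step _ _ + _)%:~R / _); lia.
have e : q = - `|q|.-1.+1%:Z by lia.
rewrite e extN abszN sign_at_pos // -(stepN `|q|.-1.+1%:Z) -(stepN `|q|.-1%:Z) addrC.
congr ((step _ _ + step _ _)%:~R / _); lia.
Qed.

(** * Deletion and insertion of a letter *)

Lemma shift_letterN i a : shift_letter i (- a) = - shift_letter i a.
Proof. by rewrite /shift_letter; do !case: ifP; lia. Qed.

(** For [i = 0] both 1 and -1 would be sent to 0. *)
Lemma shift_letter_lt i x y : (0 < i)%N -> (`|x| != i)%N -> (`|y| != i)%N ->
  (shift_letter i x < shift_letter i y) = (x < y).
Proof. by rewrite /shift_letter; do !case: ifP; lia. Qed.

(** Deleting a letter shifts the values by [shift_letter] and, symmetrically,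
    the positions by the same map. *)
Lemma ext_del m (i : 'I_m.+1) (t : sperm m.+1) q x : ext t q = i.+1%:Z ->
  (`|x| != `|q|)%N ->
  ext (rho (del i (word_of t))) (shift_letter `|q| x) = shift_letter i.+1 (ext t x).
Proof.
move=> tq xq; set d := rho _.
have qm : (`|q| <= m.+1)%N by rewrite -(ext_range t) tq /=.
have q0 : (0 < `|q|)%N.
  by case: (posnP `|q|) => // /eqP; rewrite absz_eq0 => /eqP q0; move: tq; rewrite q0 ext0.
have [p ep] : exists p, `|q|%N = p.+1 by exists `|q|.-1; lia.
have tp : `|ext t p.+1|%N = i.+1.
  have [e|e] : q = p.+1%:Z \/ p.+1%:Z = - q by lia.
    by rewrite -e tq.
  by rewrite e extN tq.
have main k : (k < m.+1)%N -> k <> p ->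
    ext d (shift_letter p.+1 k.+1) = shift_letter i.+1 (ext t k.+1).
  move=> km kp.
  (* A single letter of [t] has absolute value [i + 1]. *)
  have F : [seq a <- word_of t | `|a|%N != i.+1] =
      take p (word_of t) ++ drop p.+1 (word_of t).
    have uw : uniq (word_of t) by have := uniq_word (word_of t) => /map_uniq.
    have iw : index (ext t p.+1) (word_of t) = p.
      by rewrite -(nth_word t) ?index_uniq ?size_word; lia.
    rewrite -[in RHS]iw -remE rem_filter //; apply: eq_in_filter => a.
    rewrite word_ofE => /mapP[j _ ->] /=; rewrite -tp; congr negb.
    apply/eqP/eqP => [e|->//].
    have : ext t j.+1 = ext t p.+1 \/ ext t j.+1 = ext t (- p.+1%:Z) by rewrite extN; lia.
    by case=> [//|/ext_inj]; lia.
  have ED j : (j < m)%N -> ext d j.+1 =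
      shift_letter i.+1 (nth 0 (take p (word_of t) ++ drop p.+1 (word_of t)) j).
    move=> jm; rewrite -nth_word // /d rhoK /= F (nth_map 0) //.
    by rewrite size_cat size_take size_drop size_word; case: ifP; lia.
  case: (ltnP k p) => kp'.
    have -> : shift_letter p.+1 k.+1 = k.+1 by rewrite /shift_letter; do !case: ifP; lia.
    rewrite ED; last by lia.
    rewrite nth_cat size_take size_word; have -> : (p < m.+1)%N by lia.
    by rewrite kp' nth_take // nth_word.
  have [j ej] : exists j, k = j.+1 by exists k.-1; lia.
  have -> : shift_letter p.+1 k.+1 = j.+1 by rewrite /shift_letter; do !case: ifP; lia.
  rewrite ED; last by lia.
  rewrite nth_cat size_take size_word; have -> : (p < m.+1)%N by lia.
  have -> : (j < p)%N = false by lia.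
  by rewrite nth_drop nth_word ?ej; [congr (shift_letter _ (ext _ _)) |]; lia.
rewrite ep.
have [e|e] := leqP `|x| m.+1; last first.
  rewrite (ext_out t) // ext_out; last by rewrite /shift_letter; do !case: ifP; lia.
  by have := ltn_ord i; rewrite /shift_letter; do !case: ifP; lia.
have [x0|x0|->] := ltrgt0P x; last first.
- have -> : shift_letter p.+1 0 = 0 by [].
  by rewrite !ext0.
- have -> : x = - `|x|.-1.+1%:Z by lia.
  by rewrite extN !shift_letterN extN main //; lia.
- have -> : x = `|x|.-1.+1%:Z by lia.
  by rewrite main //; lia.
Qed.

Definition del_perm m (i : 'I_m.+1) (t : sperm m.+1) : sperm m := rho (del i (word_of t)).

Definition unshift_letter (k : nat) (y : int) : int :=
  if k%:Z <= y then y + 1 else if y <= - k%:Z then y - 1 else y.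

Lemma shift_letterK k x : (0 < k)%N -> (`|x| != k)%N ->
  unshift_letter k (shift_letter k x) = x.
Proof. by rewrite /shift_letter /unshift_letter; do !case: ifP; lia. Qed.

Lemma unshift_letterK k x : (0 < k)%N -> shift_letter k (unshift_letter k x) = x.
Proof. by rewrite /shift_letter /unshift_letter; do !case: ifP; lia. Qed.

Lemma unshift_letter_neq k x : (0 < k)%N -> (`|unshift_letter k x| != k)%N.
Proof. by rewrite /unshift_letter; do !case: ifP; lia. Qed.

Lemma unshift_letterN k x : (0 < k)%N -> unshift_letter k (- x) = - unshift_letter k x.
Proof. by rewrite /unshift_letter; do !case: ifP; lia. Qed.

Lemma absz_eqN (x y : int) : `|x|%N = `|y|%N -> x = y \/ x = - y.
Proof. lia. Qed.

Lemma ext_abs_inj n (s : sperm n) x y : (`|ext s x| == `|ext s y|)%N = (`|x| == `|y|)%N.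
Proof.
apply/eqP/eqP => e.
  by case: (absz_eqN e); rewrite -?extN => /ext_inj ->; rewrite ?abszN.
by case: (absz_eqN e) => ->; rewrite ?extN ?abszN.
Qed.

Lemma pos_range n (i : 'I_n) (t : sperm n) :
  (0 < `|ext t^-1%g i.+1| <= n)%N.
Proof.
rewrite ext_range /= ltn_ord andbT lt0n absz_eq0; apply/eqP => e.
by have := extVK t i.+1; rewrite e ext0.
Qed.

Lemma ext_del_perm m (i : 'I_m.+1) (t : sperm m.+1) q x : ext t^-1%g i.+1 = q ->
  (`|x| != `|q|)%N ->
  ext (del_perm i t) (shift_letter `|q| x) = shift_letter i.+1 (ext t x).
Proof. by move=> eq; apply: ext_del; rewrite -eq extVK. Qed.

(** Deletion commutes with inversion: deleting the value [i + 1] of [t] deletes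
    the letter [q] of [t^-1], at position [i + 1]. *)
Lemma ext_del_permV m (i : 'I_m.+1) (t : sperm m.+1) q y : ext t^-1%g i.+1 = q ->
  (`|y| != i.+1)%N ->
  ext (del_perm i t)^-1%g (shift_letter i.+1 y) = shift_letter `|q| (ext t^-1%g y).
Proof.
move=> eq yi; rewrite -{1}(extVK t y) -(ext_del_perm eq) ?extK //.
by rewrite -eq ext_abs_inj.
Qed.

Lemma del_perm_inj m (i : 'I_m.+1) (t t' : sperm m.+1) :
  del_perm i t = del_perm i t' -> ext t^-1%g i.+1 = ext t'^-1%g i.+1 -> t = t'.
Proof.
move=> ed eq; apply: ext_eq => x; set q := ext t'^-1%g i.+1 in eq.
have tq : ext t q = i.+1 by rewrite -eq extVK.
have tq' : ext t' q = i.+1 by rewrite extVK.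
have [xq|xq] := eqVneq `|x|%N `|q|%N.
  by case: (absz_eqN xq) => ->; rewrite ?extN tq tq'.
have hx : (`|ext t x| != i.+1)%N by rewrite -[i.+1]/(`|i.+1%:Z|%N) -tq ext_abs_inj.
have hx' : (`|ext t' x| != i.+1)%N by rewrite -[i.+1]/(`|i.+1%:Z|%N) -tq' ext_abs_inj.
rewrite -(shift_letterK _ hx) // -(shift_letterK _ hx') //.
by rewrite -(ext_del_perm eq) // -(@ext_del_perm _ _ _ q) // ed.
Qed.

(** The permutation obtained by inserting the letter [i + 1] at the signed
    position [q]; a negative [q] means that the letter [- (i + 1)] is
    inserted at [- q]. *)
Lemma del_perm_surj m (i : 'I_m.+1) (d : sperm m) (q : int) : (0 < `|q| <= m.+1)%N ->
  exists2 t : sperm m.+1, del_perm i t = d & ext t^-1%g i.+1 = q.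
Proof.
case/andP => q0 qm; have hi := ltn_ord i.
pose f x := if x == q then i.+1%:Z else if x == - q then - i.+1%:Z
            else unshift_letter i.+1 (ext d (shift_letter `|q| x)).
have fN x : f (- x) = - f x.
  rewrite /f; have [->|xq] := eqVneq x q.
    by rewrite eqxx; case: eqP => //; lia.
  have [->|xq'] := eqVneq x (- q).
    by rewrite opprK eqxx opprK.
  have -> : (- x == q) = false by lia.
  have -> : (- x == - q) = false by lia.
  by rewrite shift_letterN extN unshift_letterN.
have fE x : (`|x| != `|q|)%N -> f x = unshift_letter i.+1 (ext d (shift_letter `|q| x)).
  by move=> h; rewrite /f; do 2?[case: eqP => [?|_]; first lia].
have fq : f q = i.+1 by rewrite /f eqxx.
have fne x : (`|x| != `|q|)%N -> (`|f x| != i.+1)%N.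
  by move=> h; rewrite fE // unshift_letter_neq.
have fI : injective f.
  have fa x : (`|x| = `|q|)%N -> (`|f x| = i.+1)%N.
    by move=> h; case: (absz_eqN h) => ->; rewrite ?fN fq ?abszN.
  move=> x y e.
  have [xq|xq] := eqVneq `|x|%N `|q|%N; have [yq|yq] := eqVneq `|y|%N `|q|%N.
  - move: e; case: (absz_eqN xq) => ->; case: (absz_eqN yq) => -> //; rewrite fN fq; lia.
  - by have := fne _ yq; rewrite -e fa ?eqxx.
  - by have := fne _ xq; rewrite e fa ?eqxx.
  move: e; rewrite !fE // => /(congr1 (shift_letter i.+1)); rewrite !unshift_letterK //.
  by move=> /ext_inj /(congr1 (unshift_letter `|q|)); rewrite !shift_letterK.
have fle x : (`|x| <= m.+1)%N -> (`|f x| <= m.+1)%N.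
  move=> h; have [xq|xq] := eqVneq `|x|%N `|q|%N.
    by case: (absz_eqN xq) => ->; rewrite ?fN fq ?abszN.
  rewrite fE //.
  have : (`|ext d (shift_letter `|q| x)| <= m)%N.
    by rewrite ext_range /shift_letter; do !case: ifP; lia.
  by rewrite /unshift_letter; do !case: ifP; lia.
have [t tf] := ext_realize fI fN fle; exists t; last by rewrite -fq -tf // extK.
apply: ext_eq => y.
have [ym|ym] := leqP `|y| m; last by rewrite !ext_out.
rewrite -(unshift_letterK y q0); set x := unshift_letter _ _.
have xq : (`|x| != `|q|)%N by apply: unshift_letter_neq.
have xm : (`|x| <= m.+1)%N by rewrite /x /unshift_letter; do !case: ifP; lia.
rewrite (@ext_del_perm _ _ _ q) ?tf ?fE ?unshift_letterK //.
by rewrite -fq -tf // extK.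
Qed.

(** * Signs and descents of an insertion *)

(** The gap [g] lies between the positions [g] and [g + 1] of the extended word
    of rank one less; a letter inserted there gets position [g + 1] if it is on
    the right of position 0 and [g] if it is on the left. *)
Definition gap_of (q : int) : int := if 0 < q then q - 1 else q.

(** The letter [i] of [d] stays [i] after the insertion of [i + 1], and the letter
    [i + 1] becomes [i + 2]; hence the threshold [i]. *)
Definition below m (i : nat) (d : sperm m) (x : int) : int :=
  if ext d x <= i%:Z then 1 else -1.

Lemma sign_at_gap m (i : 'I_m.+1) (t : sperm m.+1) (d : sperm m) q :
  del_perm i t = d -> ext t^-1%g i.+1 = q ->
  sign_at i.+1 (word_of t) = (below i d (gap_of q) - below i d (gap_of q + 1))%:~R / 2%:R.
Proof.
move=> td tq; have := pos_range i t; rewrite tq => /andP[q0 qm].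
have qt : ext t q = i.+1 by rewrite -tq extVK.
have -> : i.+1 = `|ext t q|%N by rewrite qt.
rewrite sign_at_signed //; last by lia.
congr (_%:~R / _); rewrite /step (_ : q - 1 + 1 = q); last by lia.
rewrite qt /below -td.
have sl : shift_letter `|q| (q - 1) = gap_of q.
  by rewrite /shift_letter /gap_of; do !case: ifP; lia.
have sr : shift_letter `|q| (q + 1) = gap_of q + 1.
  by rewrite /shift_letter /gap_of; do !case: ifP; lia.
have nl : absz (q - 1)%R != `|q|%N by lia.
have nr : absz (q + 1)%R != `|q|%N by lia.
have := nl; rewrite -(ext_abs_inj t) qt /= => nl'.
have := nr; rewrite -(ext_abs_inj t) qt /= => nr'.
rewrite -sr -sl !(@ext_del_perm _ _ _ q) //.
move: (ext t (q - 1)) (ext t (q + 1)) nl' nr' => a b.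
by rewrite /shift_letter; do !case: ifP; lia.
Qed.

(** The part of the descent condition that does not see the value (or position)
    [i + 1]: the pairs [(k, k + 1)] before it keep their names, the later
    ones are renamed [(k + 1, k + 2)]. *)
Definition compat_off m (i : nat) (s : sperm m.+1) (d : sperm m) : bool :=
  [forall k : 'I_m, ((k < i)%N ==> asc (ext s) k%:Z ==> asc (ext d^-1%g) k%:Z) &&
    ((i < k)%N ==> asc (ext s) k.+1%:Z ==> asc (ext d^-1%g) k%:Z)].

Lemma shift_small k (x : int) : (`|x| <= k)%N -> shift_letter k x = x.
Proof. by rewrite /shift_letter; do !case: ifP; lia. Qed.

Lemma shift_big k (x : nat) : (k <= x)%N -> shift_letter k x.+1 = x.
Proof. by rewrite /shift_letter; do !case: ifP; lia. Qed.

(** Besides the pairs avoiding [i + 1], the descents of [t^-1] at [i] and [i + 1]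
    compare the inserted letter with its neighbours in value, whose positions
    in [d] are [ext d^-1 i] and [ext d^-1 (i + 1)].  For [i = m] there is no letter
    [i + 2]; [asc (ext s) i.+1] is then false, the next letter being [-oo]. *)
Lemma Des_insertion m (i : 'I_m.+1) (s t : sperm m.+1) (d : sperm m) q :
  del_perm i t = d -> ext t^-1%g i.+1 = q ->
  (Des t^-1%g \subset Des s) =
  [&& compat_off i s d, asc (ext s) i ==> (ext d^-1%g i <= gap_of q) &
      asc (ext s) i.+1 ==> (gap_of q < ext d^-1%g i.+1)].
Proof.
move=> td tq; have := pos_range i t; rewrite tq => /andP[q0 qm].
have tne y : (`|y| != i.+1)%N -> (`|ext t^-1%g y| != `|q|)%N.
  by move=> h; rewrite -tq ext_abs_inj.
have sh y : (`|y| != i.+1)%N ->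
    ext d^-1%g (shift_letter i.+1 y) = shift_letter `|q| (ext t^-1%g y).
  by move=> h; rewrite -td (ext_del_permV tq).
have shlt y z : (`|y| != i.+1)%N -> (`|z| != i.+1)%N ->
    (ext d^-1%g (shift_letter i.+1 y) < ext d^-1%g (shift_letter i.+1 z)) =
    (ext t^-1%g y < ext t^-1%g z).
  by move=> hy hz; rewrite !sh // shift_letter_lt // tne.
have lo (k : nat) : (k < i)%N -> asc (ext d^-1%g) k = asc (ext t^-1%g) k.
  move=> ki; rewrite /asc -PoszD addn1 -shlt; try lia.
  by rewrite !shift_small //; lia.
have hi (k : nat) : (i < k)%N -> asc (ext d^-1%g) k = asc (ext t^-1%g) k.+1.
  move=> ki; rewrite /asc -!PoszD !addn1 -shlt; try lia.
  by rewrite !shift_big //; lia.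
have mid1 : asc (ext t^-1%g) i = (ext d^-1%g i <= gap_of q).
  have := tne i; have := sh i; rewrite shift_small; last by lia.
  rewrite /asc -PoszD addn1 tq => -> ; last by lia.
  move=> /(_ ltac:(lia)); rewrite /shift_letter /gap_of.
  by move: (ext _ _) => a; do !case: ifP; lia.
have mid2 : asc (ext t^-1%g) i.+1 = (gap_of q < ext d^-1%g i.+1).
  have := tne i.+2; have := sh i.+2; rewrite shift_big; last by lia.
  rewrite /asc -PoszD addn1 tq => -> ; last by lia.
  move=> /(_ ltac:(lia)); rewrite /shift_letter /gap_of.
  by move: (ext _ _) => a; do !case: ifP; lia.
rewrite Des_subset -mid1 -mid2; have im := ltn_ord i.
apply/forallP/and3P => [h|[/forallP ha h1 h2] k].
  have {}h k : (k <= m)%N -> asc (ext s) k%:Z ==> asc (ext t^-1%g) k%:Z.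
    by move=> km; have hk : (k < m.+1)%N by []; exact: (h (Ordinal hk)).
  split; last 2 first.
  - by apply: h.
  - have [e|e] := eqVneq i.+1 m.+1; first by rewrite asc_last // e.
    by apply: h; lia.
  apply/forallP => k; have hk := ltn_ord k; apply/andP; split; apply/implyP => ki.
    by rewrite lo //; apply: h; lia.
  by rewrite hi //; apply: h; lia.
have [ki|ki|ki] := ltngtP k i.
- have hk : (k < m)%N by lia.
  by have := ha (Ordinal hk); rewrite /= ki lo // => /andP[].
- have [e|ne] := eqVneq (k : nat) i.+1; first by rewrite e.
  have [j ej] : exists j, (k : nat) = j.+1 by exists k.-1; lia.
  have hj : (j < m)%N by have := ltn_ord k; lia.
  have ij : (i < j)%N by lia.
  by rewrite ej; have := ha (Ordinal hj); rewrite /= ij hi // => /andP[].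
- by rewrite ki.
Qed.

(** Here [j + 1] is, up to sign, the letter of [s] at position [i + 1].  Its removal
    makes the positions [i] and [i + 2] adjacent, which is the only new
    comparison. *)
Lemma Des_deletion m (i j : 'I_m.+1) (s : sperm m.+1) (d : sperm m) :
  `|ext s i.+1|%N = j.+1 ->
  (Des d^-1%g \subset Des (del_perm j s)) =
  compat_off i s d && ((ext s i < ext s i.+2) ==> (ext d^-1%g i < ext d^-1%g i.+1)).
Proof.
move=> sij; set q := ext s^-1%g j.+1.
have sq : ext s q = j.+1 by rewrite extVK.
have qi : `|q|%N = i.+1.
  by apply/eqP; rewrite -[i.+1]/(`|i.+1%:Z|%N) -(ext_abs_inj s) sq sij.
have sne y : (`|y| != i.+1)%N -> (`|ext s y| != j.+1)%N.
  by move=> h; rewrite -[j.+1]/(`|j.+1%:Z|%N) -sq ext_abs_inj qi.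
have shlt y z : (`|y| != i.+1)%N -> (`|z| != i.+1)%N ->
    (ext (del_perm j s) (shift_letter i.+1 y) < ext (del_perm j s) (shift_letter i.+1 z)) =
    (ext s y < ext s z).
  by move=> hy hz; rewrite -qi !(@ext_del_perm _ _ _ q) ?qi // shift_letter_lt // sne.
have lo (k : nat) : (k < i)%N -> asc (ext (del_perm j s)) k = asc (ext s) k.
  move=> ki; rewrite /asc -PoszD addn1 -shlt; try lia.
  by rewrite !shift_small //; lia.
have hi (k : nat) : (i < k)%N -> asc (ext (del_perm j s)) k = asc (ext s) k.+1.
  move=> ki; rewrite /asc -!PoszD !addn1 -shlt; try lia.
  by rewrite !shift_big //; lia.
have mid : asc (ext (del_perm j s)) i = (ext s i < ext s i.+2).
  by rewrite -shlt; try lia; rewrite shift_small ?shift_big /asc -?PoszD ?addn1 //; lia.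
have -> : (ext d^-1%g i < ext d^-1%g i.+1) = asc (ext d^-1%g) i by rewrite /asc -PoszD addn1.
rewrite Des_subset -mid; have im := ltn_ord i.
apply/forallP/andP => [h|[/forallP ha h1] k].
  split.
    apply/forallP => k; apply/andP; split; apply/implyP => ki.
      by have := h k; rewrite lo.
    by have := h k; rewrite hi.
  have [e|e] := eqVneq (i : nat) m; first by rewrite asc_last // e.
  have hm : (i < m)%N by lia.
  exact: (h (Ordinal hm)).
have [ki|ki|ki] := ltngtP k i.
- by rewrite lo //; have := ha k; rewrite ki => /andP[].
- by rewrite hi //; have := ha k; rewrite ki => /andP[].
- by rewrite ki.
Qed.

Lemma telescope_nat (V : zmodType) (h : nat -> V) a b n :
  \sum_(j < n) (if (a <= j < b)%N then h j - h j.+1 else 0) =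
  if (a <= minn b n)%N then h a - h (minn b n) else 0.
Proof.
elim: n => [|n IH].
  by rewrite big_ord0 minn0 leqn0; case: eqP => [->|]; rewrite ?subrr.
rewrite big_ord_recr IH /=.
have [bn|bn] := leqP b n.
  have -> : minn b n.+1 = b by lia.
  by rewrite andbF addr0.
have -> : minn b n.+1 = n.+1 by lia.
rewrite andbT; case: (ltngtP a n.+1) => an.
- have -> : (a <= n)%N by lia.
  by rewrite addrA subrK.
- have -> : (a <= n)%N = false by lia.
  by rewrite addr0.
- have -> : (a <= n)%N = false by lia.
  by rewrite an subrr addr0.
Qed.

Lemma telescope_int (V : zmodType) (h : int -> V) (lo hi : int) N M : (N.*2 <= M)%N ->
  (`|lo| <= N)%N -> (`|hi| <= N)%N ->
  \sum_(j < M) (if (lo <= j%:Z - N%:Z) && (j%:Z - N%:Z < hi)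
     then h (j%:Z - N%:Z) - h (j%:Z - N%:Z + 1) else 0) =
  if lo <= hi then h lo - h hi else 0.
Proof.
move=> NM hlo hhi.
pose a := absz (lo + N%:Z); pose b := absz (hi + N%:Z); pose H k := h (k%:Z - N%:Z).
have Ha : h lo = H a by congr h; lia.
have Hb : h hi = H (minn b M) by congr h; lia.
have -> : (lo <= hi) = (a <= minn b M)%N by lia.
rewrite Ha Hb -telescope_nat.
apply: eq_bigr => j _; have hj := ltn_ord j.
have -> : (lo <= j%:Z - N%:Z) && (j%:Z - N%:Z < hi) = (a <= j < b)%N by lia.
by congr (if _ then _ - h _ else _); lia.
Qed.

(** * The sum of the signs over all insertions *)

Lemma ext_le n (s : sperm n) x k : (n <= k)%N -> (`|x| <= k)%N -> (`|ext s x| <= k)%N.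
Proof.
move=> nk xk; have [h|h] := leqP `|x| n; last by rewrite ext_out ?abszN.
by rewrite (leq_trans _ nk) // ext_range.
Qed.

(** The insertions allowed by the descent condition are those in the gaps from
    [lo] to [up], and their signs telescope. *)
Lemma sum_sign_fiber m (i : 'I_m.+1) (s : sperm m.+1) (d : sperm m) :
  \sum_(t : sperm m.+1 | (Des t^-1%g \subset Des s) && (del_perm i t == d))
     sign_at i.+1 (word_of t) =
  (step (ext s) i + step (ext s) i.+1)%:~R / 2%:R *
  (compat_off i s d && ((ext s i < ext s i.+2) ==> (ext d^-1%g i < ext d^-1%g i.+1)))%:R.
Proof.
have hi := ltn_ord i.
pose lo := if asc (ext s) i then ext d^-1%g i else - m.+1%:Z.
pose up := if asc (ext s) i.+1 then ext d^-1%g i.+1 else m.+1%:Z.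
pose gap (j : 'I_m.*2.+2) : int := j%:Z - m.+1%:Z.
pose idx (t : sperm m.+1) : 'I_m.*2.+2 :=
  inord (absz (gap_of (ext t^-1%g i.+1) + m.+1%:Z)).
have idxE t : gap (idx t) = gap_of (ext t^-1%g i.+1).
  have := pos_range i t; rewrite /gap /idx /gap_of; move: (ext _ _) => q qm.
  by rewrite inordK; case: ifP; lia.
rewrite (partition_big idx predT) //=.
have E (j : 'I_m.*2.+2) :
   \sum_(t : sperm m.+1 | (Des t^-1%g \subset Des s) && (del_perm i t == d) && (idx t == j))
     sign_at i.+1 (word_of t) =
   (compat_off i s d)%:R / 2%:R * (if (lo <= gap j) && (gap j < up)
     then below i d (gap j) - below i d (gap j + 1) else 0)%:~R.
  have hj := ltn_ord j.
  pose q := if 0 <= gap j then gap j + 1 else gap j.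
  have qm : (0 < `|q| <= m.+1)%N by rewrite /q /gap; case: ifP; lia.
  have gq : gap_of q = gap j by rewrite /q /gap_of; do !case: ifP; lia.
  have [t td tq] := del_perm_surj i d qm.
  have tj : idx t = j.
    by apply: val_inj; have := idxE t; rewrite tq gq /gap /=; lia.
  have tu t' : del_perm i t' = d -> idx t' = j -> t' = t.
    move=> td' tj'; apply: (@del_perm_inj _ i); first by rewrite td.
    have := idxE t'; rewrite tj' -tj idxE tq; have := pos_range i t'.
    move: (ext _ _) => q'; case/andP: qm => q0 _; rewrite /gap_of.
    by do !case: ifP; lia.
  have C : (Des t^-1%g \subset Des s) = compat_off i s d && ((lo <= gap j) && (gap j < up)).
    rewrite (Des_insertion _ td tq) gq /lo /up.
    by case: (compat_off _ _ _) => //=; do 2!case: (asc _ _) => //=; rewrite /gap; lia.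
  have [c|c] := boolP (Des t^-1%g \subset Des s); last first.
    rewrite big_pred0 => [|t'].
      move: c; rewrite C; case: (compat_off _ _ _) => /=; rewrite ?mul0r //.
      by move=> /negbTE ->; rewrite mulr0.
    apply/negP => /andP[/andP[c' /eqP td'] /eqP tj'].
    by rewrite -(tu _ td' tj') c' in c.
  rewrite (big_pred1 t) => [|t'].
    by move: c; rewrite C => /andP[-> ->]; rewrite (sign_at_gap td tq) gq mul1r mulrC.
  apply/andP/eqP => [[/andP[_ /eqP td'] /eqP]|->]; first exact: tu.
  by rewrite c td tj !eqxx.
under eq_bigr do rewrite E.
rewrite -mulr_sumr -rmorph_sum /= (@telescope_int _ _ _ _ m.+1); first last.
- by rewrite /up; case: ifP => // _; apply: ext_le.
- by rewrite /lo; case: ifP => _; [apply: ext_le|]; lia.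
- by rewrite doubleS.
(* At the left end the letter is [i] itself, or [m + 1] at position [-(m + 1)]. *)
have Hlo : below i d lo = step (ext s) i.
  rewrite step_ext /lo /below; case: (asc _ _); first by rewrite extVK lexx.
  by rewrite extN ext_out ?opprK //; case: ifP => //; lia.
have Hup : below i d up = - step (ext s) i.+1.
  rewrite step_ext /up /below; case: (asc _ _); first by rewrite extVK; case: ifP; lia.
  by rewrite ext_out //; case: ifP => //; lia.
rewrite Hlo Hup opprK !step_ext /lo /up.
have ne : ext d^-1%g i <> ext d^-1%g i.+1 by move=> /ext_inj; lia.
(* At two ascents of [s] the interval of gaps must be nonempty; at an ascent and
   a descent both sides vanish; two descents leave the interval unbounded. *)
have tr : asc (ext s) i -> asc (ext s) i.+1 -> ext s i < ext s i.+2.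
  by rewrite /asc -!PoszD !addn1; apply: lt_trans.
have tr' : ~~ asc (ext s) i -> ~~ asc (ext s) i.+1 -> (ext s i < ext s i.+2) = false.
  rewrite /asc -!PoszD !addn1 -!leNgt => h1 h2.
  by apply/negbTE; rewrite -leNgt; apply: le_trans h1.
case: (compat_off _ _ _); rewrite /= ?mul0r ?mulr0 //.
case: (boolP (asc (ext s) i)) tr tr' => a1; case: (boolP (asc (ext s) i.+1)) => a2 //= tr tr'.
- rewrite tr //= lt_neqAle; have -> /= : ext d^-1%g i != ext d^-1%g i.+1 by apply/eqP.
  by case: ifP => _; rewrite ?mulr1 ?mulr0 // mul1r mulrC.
- by rewrite subrr if_same mulr0 !mul0r.
- by rewrite addNr if_same mulr0 !mul0r.
- by rewrite tr' //= mulr1 mul1r mulrC; case: ifP => //; lia.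
Qed.

(** * Commutation *)

Lemma Phi_basis n (s : sperm n) :
  Phi (basis s) = \sum_(t : sperm n | Des t^-1%g \subset Des s) basis t.
Proof. exact: linext_basis. Qed.

Lemma partial_basisE n (s : sperm n) : partial (basis s) = partial_basis s.
Proof. exact: linext_basis. Qed.

(** The faces of [s] are indexed by the absolute values of its letters; this
    reindexes them by positions, as [sum_sign_fiber] requires. *)
Lemma partial_position m (s : sperm m.+1) : exists2 v : 'I_m.+1 -> 'I_m.+1, 
  injective v & forall i : 'I_m.+1, `|ext s i.+1|%N = (v i).+1.
Proof.
have h (i : 'I_m.+1) : (`|ext s i.+1|.-1 < m.+1)%N.
  by have := pos_range i s^-1%g; rewrite invgK; lia.
exists (fun i => Ordinal (h i)); last first.
  by move=> i /=; have := pos_range i s^-1%g; rewrite invgK; lia.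
move=> i j /(congr1 val) /= e; apply: val_inj.
have /eqP : `|ext s i.+1|%N = `|ext s j.+1|%N.
  by have := pos_range i s^-1%g; have := pos_range j s^-1%g; rewrite invgK; lia.
by rewrite ext_abs_inj /= => /eqP [].
Qed.

Lemma commute_basis n (s : sperm n) : Phi (partial (basis s)) = partial (Phi (basis s)).
Proof.
rewrite Phi_basis partial_basisE linear_sum.
under [RHS]eq_bigr do rewrite partial_basisE.
case: n s => [|m] s.
  by rewrite linear0 big1.
rewrite /partial_basis exchange_big linear_sum /=.
have [v vI vE] := partial_position s.
rewrite (reindex_inj vI) /=; apply: eq_bigr => i _.
rewrite /face linearZ /= Phi_basis.
rewrite [RHS](partition_big (del_perm i) predT) //= scaler_sumr.
rewrite big_mkcond /=; apply: eq_bigr => d _.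
transitivity ((\sum_(t : sperm m.+1 | (Des t^-1%g \subset Des s) && (del_perm i t == d))
     sign_at i.+1 (word_of t)) *: basis d).
  rewrite sum_sign_fiber -(Des_deletion _ (vE i)) -(vE i) sign_at_pos //.
  by rewrite /del_perm; case: ifP; rewrite ?mulr1 // mulr0 scale0r.
by rewrite scaler_suml; apply: eq_bigr => t /andP[_ /eqP <-].
Qed.

Theorem theorem3p1 : Phi \o partial =1 partial \o Phi.
Proof.
move=> g /=.
have -> : g = \sum_(k <- msupp g) g@_k *: basis (tagged k).
  rewrite [LHS]monalgE; apply: eq_bigr => -[n s] _; apply/malgP => k.
  by rewrite mcoeffZ !mcoeffU mulr_natr.
rewrite (linear_sum partial) (linear_sum Phi) (linear_sum Phi) (linear_sum partial).
by apply: eq_bigr => k _; rewrite !linearZ /= commute_basis.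
Qed.
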